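(* Assume that the event $\bigcup_{j=0}^N\{V_{t_j+}=P_{t_j}\}$ has probability zero. Then for any $t\in[0,T]$, as $\lambda\downarrow0$, the random time $\tau^\lambda_t$ converges almost surely to the stopping time $\tau^*_t$.
   Context: Setting. $(\Omega,\mathcal F,\mathbb P,\mathbb F)$ is a filtered probability space whose filtration $\mathbb F=(\mathcal F_t)_{t\ge0}$ satisfies the usual conditions; martingales are càdlàg. $T>0$, $S=\{t_0,t_1,\dots,t_N\}$ with $0=t_0<t_1<\dots<t_N<T$, and $t_{N+1}:=T$. $P$ is a non-negative $\mathbb F$-adapted process with $\max_{u\in S\cup\{T\}}\mathbb E[P_u]<\infty$. $\mathcal T_{t,T}(S)$ is the set of $\mathbb F$-stopping times with values in $(S\cup\{T\})\cap[t,T]$. $X_{t+}$ denotes the right limit of a process $X$ at $t$. Value process. $V_t=\operatorname{ess\,sup}_{\tau\in\mathcal T_{t,T}(S)}\mathbb E[P_\tau|\mathcal F_t]$; it satisfies $V_t=P_T-(M_T-M_t)+\sum_{t\le t_i<T}(P_{t_i}-V_{t_i+})^+$ with $M$ a uniformly integrable martingale. For $t\in[0,T]$, $\tau^*_t=\inf\{s\in S\cup\{T\}:\ s\ge t,\ V_s=P_s\}$. Entropy-regularised value. For $x\ne0$, $\Psi(x)=\frac1x\ln\big(\frac{e^x-1}{x}\big)$, $\Psi(0)=\frac12$, $\Phi(x)=x\Psi(x)$. For $\lambda>0$, $(V^\lambda,M^\lambda)$ is the unique pair ($V^\lambda$ of class (D), $M^\lambda$ a uniformly integrable martingale with $M^\lambda_0=0$)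 solving $V^\lambda_t=P_T-(M^\lambda_T-M^\lambda_t)+\sum_{t\le t_i<T}\lambda\Phi(\lambda^{-1}(P_{t_i}-V^\lambda_{t_i+}))$, $t\in[0,T]$. Equivalently: $V^\lambda_T=P_T$, $V^\lambda_t=\mathbb E[V^\lambda_{t_{j+1}}|\mathcal F_t]$ for $t\in(t_j,t_{j+1}]$, $V^\lambda_{t_j+}=\mathbb E[V^\lambda_{t_{j+1}}|\mathcal F_{t_j}]$ and $V^\lambda_{t_j}=V^\lambda_{t_j+}+\lambda\Phi(\lambda^{-1}(P_{t_j}-V^\lambda_{t_j+}))$. Randomised stopping time. Let $U$ be uniform on $[0,1]$, independent of $\mathcal F_\infty$. For $\lambda>0$ put $\Delta\Gamma^\lambda_{t_i}=\Psi\big(\lambda^{-1}(P_{t_i}-V^\lambda_{t_i+})\big)$, $i=0,\dots,N$, and for $t\le s$ put $\mathcal E_{t,s}(-\Gamma^\lambda_-)=\prod_{i:\ t\le t_i<s}(1-\Delta\Gamma^\lambda_{t_i})$ (empty product $=1$). Then $$\tau^\lambda_t=\inf\{s\ge t:\ 1-\mathcal E_{t,s}(-\Gamma^\lambda_-)\ge U\}\wedge T,$$ with $\inf\emptyset=+\infty$. *)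

(* Defs.v *)
From HB Require Import structures.
From mathcomp Require Import all_boot all_order all_algebra.
From mathcomp Require Import all_classical all_reals all_analysis.
Set Implicit Arguments.
Unset Strict Implicit.
Unset Printing Implicit Defensive.
Import Order.TTheory GRing.Theory Num.Theory.
Import numFieldNormedType.Exports.
Local Open Scope classical_set_scope.
Local Open Scope ring_scope.

Section probability_notions.
Context (d : measure_display) (Om : measurableType d) (R : realType).
Variable Pr : probability Om R.

(** Sub-sigma-algebras of the ambient one are handled as set systems. *)
Definition measurable_wrt (G : set (set Om)) (X : Om -> R) : Prop :=
  forall B : set R, measurable B -> G (X @^-1` B).

Definition integrable_rv (X : Om -> R) : Prop :=
  Pr.-integrable setT (EFin \o X).

(** [Y] is a version of E[X | G]. *)
Definition is_condexp (G : set (set Om)) (X Y : Om -> R) : Prop :=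
  [/\ integrable_rv X, integrable_rv Y, measurable_wrt G Y &
      forall A, G A ->
        (\int[Pr]_(w in A) (Y w)%:E = \int[Pr]_(w in A) (X w)%:E)%E].

(** [Y] is a version of the essential supremum of the family [XX]; the
    library's [ess_sup] is that of a single function. *)
Definition is_esssup (XX : set (Om -> R)) (Y : Om -> R) : Prop :=
  [/\ measurable_fun setT Y,
      forall X, XX X -> {ae Pr, forall w, X w <= Y w} &
      forall Z : Om -> R, measurable_fun setT Z ->
        (forall X, XX X -> {ae Pr, forall w, X w <= Z w}) ->
        {ae Pr, forall w, Y w <= Z w}].

Definition uniformly_integrable (XX : set (Om -> R)) : Prop :=
  (forall X, XX X -> integrable_rv X) /\
  forall eps : R, 0 < eps -> exists K : R, forall X, XX X ->
    (\int[Pr]_(w in [set w | (K <= `|X w|)%R]) `|X w|%:E <= eps%:E)%E.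

(** Times are real numbers; only the indices [t >= 0] are meaningful. *)
Record usual_filtration (F : R -> set (set Om)) : Prop := UsualFiltration {
  filt_sigma : forall t, 0 <= t -> sigma_algebra setT (F t);
  filt_sub : forall t, 0 <= t -> F t `<=` measurable;
  filt_mono : forall s t, 0 <= s -> s <= t -> F s `<=` F t;
  filt_right_continuous :
    forall t, 0 <= t -> \bigcap_(s in [set s | t < s]) F s `<=` F t;
  filt_complete : Pr.-negligible `<=` F 0 }.

Definition F_infty (F : R -> set (set Om)) : set (set Om) :=
  <<s \bigcup_(t in [set t | 0 <= t]) F t >>.

Definition stopping_time (F : R -> set (set Om)) (tau : Om -> R) : Prop :=
  forall s, 0 <= s -> F s [set w | tau w <= s].

Definition stopped (X : R -> Om -> R) (tau : Om -> R) : Om -> R :=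
  fun w => X (tau w) w.

Definition right_lim (X : R -> Om -> R) (t : R) (w : Om) : R :=
  lim (X s w @[s --> t^'+]).

Definition cadlag (T : R) (x : R -> R) : Prop :=
  (forall t, 0 <= t -> t < T -> x s @[s --> t^'+] --> x t) /\
  (forall t, 0 < t -> t <= T -> cvg (x s @[s --> t^'-])).

Definition adapted (F : R -> set (set Om)) (T : R) (X : R -> Om -> R) : Prop :=
  forall t, 0 <= t <= T -> measurable_wrt (F t) (X t).

(** A uniformly integrable martingale on [0, T] (the restriction to [0, T] of
    a uniformly integrable martingale on [0, +oo[ is one). *)
Record ui_martingale (F : R -> set (set Om)) (T : R) (M : R -> Om -> R) :
    Prop := UiMartingale {
  mart_adapted : adapted F T M;
  mart_condexp : forall s t, 0 <= s -> s <= t -> t <= T ->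
    is_condexp (F s) (M t) (M s);
  mart_ui : uniformly_integrable [set M t | t in [set t | 0 <= t <= T]];
  mart_cadlag : {ae Pr, forall w, cadlag T (fun t => M t w)} }.

Definition class_D (F : R -> set (set Om)) (T : R) (X : R -> Om -> R) : Prop :=
  uniformly_integrable
    [set stopped X tau | tau in [set tau | stopping_time F tau /\
                                           forall w, 0 <= tau w <= T]].

Definition uniform01 (U : Om -> R) : Prop :=
  measurable_fun setT U /\
  forall B : set R, measurable B -> Pr (U @^-1` B) = uniform_prob (@ltr01 R) B.

Definition independent_of (G : set (set Om)) (U : Om -> R) : Prop :=
  forall (A : set Om) (B : set R), G A -> measurable B ->
    (Pr (A `&` U @^-1` B) = Pr A * Pr (U @^-1` B))%E.

End probability_notions.

Section stopping_problem.
Context (d : measure_display) (Om : measurableType d) (R : realType).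
Variable Pr : probability Om R.
Variable F : R -> set (set Om).
Variables (T : R) (N : nat) (g : 'I_N.+1 -> R).
Variable P : R -> Om -> R.

(** [g] enumerates S = {t_0, ..., t_N}. *)
Record exercise_grid : Prop := ExerciseGrid {
  grid0 : g ord0 = 0;
  grid_incr : forall i j : 'I_N.+1, (i < j)%N -> g i < g j;
  grid_lt : g ord_max < T }.

Definition exercise_dates : set R := range g `|` [set T].

Record payoff_process : Prop := PayoffProcess {
  payoff_ge0 : forall t w, 0 <= t <= T -> 0 <= P t w;
  payoff_adapted : adapted F T P;
  payoff_integrable : forall u, exercise_dates u -> ('E_Pr[P u] < +oo)%E }.

(** T_{t,T}(S) *)
Definition exercise_times (t : R) : set (Om -> R) :=
  [set tau | stopping_time F tau /\
             forall w, exercise_dates (tau w) /\ t <= tau w <= T].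

(** V_t = P_T - (M_T - M_t) + sum_{t <= t_i < T} f (P_{t_i} - V_{t_i+})
    for all t in [0, T], up to indistinguishability. *)
Definition reward_equation (f : R -> R) (V M : R -> Om -> R) : Prop :=
  {ae Pr, forall w, forall t, 0 <= t <= T ->
    V t w = P T w - (M T w - M t w)
      + \sum_(i < N.+1 | t <= g i < T) f (P (g i) w - right_lim V (g i) w)}.

(** The essential supremum determines each V_t only up to a null set; the
    equation selects the version with right limits for which V_{t+} is
    meaningful. *)
Record value_process (V M : R -> Om -> R) : Prop := ValueProcess {
  value_adapted : adapted F T V;
  value_esssup : forall t, 0 <= t <= T ->
    is_esssup Pr
      [set Z | exists2 tau, exercise_times t tau &
                            is_condexp Pr (F t) (stopped P tau) Z]
      (V t);
  value_martingale : ui_martingale Pr F T M;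
  value_equation : reward_equation (fun x => Num.max x 0) V M }.

(** tau^*_t *)
Definition tau_star (V : R -> Om -> R) (t : R) (w : Om) : \bar R :=
  ereal_inf [set s%:E | s in
    [set s | [/\ exercise_dates s, t <= s & V s w = P s w]]].

Definition Psi (x : R) : R :=
  if x == 0 then 2^-1 else x^-1 * ln ((expR x - 1) / x).

Definition Phi (x : R) : R := x * Psi x.

(** (V, M) solves the equation for the entropy-regularised value with
    parameter lam. *)
Record entropy_value (lam : R) (V M : R -> Om -> R) : Prop := EntropyValue {
  entropy_adapted : adapted F T V;
  entropy_class_D : class_D Pr F T V;
  entropy_martingale : ui_martingale Pr F T M;
  entropy_M0 : {ae Pr, forall w, M 0 w = 0};
  entropy_equation : reward_equation (fun x => lam * Phi (lam^-1 * x)) V M }.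

(** The jump of Gamma^lam at t_i; [V] stands for V^lam. *)
Definition dGamma (lam : R) (V : R -> Om -> R) (i : 'I_N.+1) (w : Om) : R :=
  Psi (lam^-1 * (P (g i) w - right_lim V (g i) w)).

(** E_{t,s}(-Gamma^lam_-) *)
Definition survival (lam : R) (V : R -> Om -> R) (t s : R) (w : Om) : R :=
  \prod_(i < N.+1 | t <= g i < s) (1 - dGamma lam V i w).

(** tau^lam_t *)
Definition tau_rand (U : Om -> R) (lam : R) (V : R -> Om -> R) (t : R)
    (w : Om) : \bar R :=
  Order.min
    (ereal_inf [set s%:E | s in
      [set s | t <= s /\ U w <= 1 - survival lam V t s w]])
    T%:E.

(** [V'] is another version of the family V^lam, lam > 0. *)
Definition same_versions (V V' : R -> R -> Om -> R) : Prop :=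
  forall lam, 0 < lam ->
    {ae Pr, forall w, forall s, 0 <= s <= T -> V' lam s w = V lam s w}.

End stopping_problem.

(* Main.v *)
Require Import Defs.
From mathcomp Require Import all_boot all_order all_algebra.
From mathcomp Require Import all_classical all_reals all_analysis.
From mathcomp Require Import lra ring.
Import Order.TTheory GRing.Theory Num.Theory.
Import numFieldNormedType.Exports measurable_realfun.
Local Open Scope classical_set_scope.
Local Open Scope ring_scope.
Set Implicit Arguments.
Unset Strict Implicit.
Unset Printing Implicit Defensive.

(** Subtracting the two backward recursions gives an explicit rate: for each
    lam > 0 the continuation values satisfy, almost surely and for every j,
      0 <= V_{t_j+} - V^lam_{t_j+} <= sqrt lam * (N + 1) * (1 + V_{t_j+}).

    At an exercise date, lam * Phi (x / lam) replaces the positive part x^+.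
    It lies between min (x, 0) and x^+, and it is below x^+ by at most
    lam * ln (1 + |x| / lam) <= sqrt lam * (1 + |x|) ([scaled_Phi_bounds],
    [scaled_Phi_ge]). Here x is the gap between the payoff and the continuation
    value, and |x| is at most the value itself, so each date costs at most
    sqrt lam * (1 + V) ([sandwiched_jump]). Between dates both processes follow
    martingales; since the three inequalities of [sandwiched] are affine in
    (V, V^lam), they are transported backwards in time: an affine combination
    negative on a non-null event of F_s would have a strictly negative
    martingale increment there, whose mean is zero ([affine_ge0_backward]).
    The error k * (1 + V) is itself affine in V, which is why it goes through
    the same transport; the right limits are then taken along a sequence of
    times. Induction on the number of remaining dates gives the rate
    ([ae_sandwiched], [ae_sandwiched_grid_right]).

    On a path with V_{t_j+} <> P_{t_j} for all j, the arguments of Psi therefore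
    tend to +oo where stopping is optimal and to -oo elsewhere, so that the
    jumps of Gamma^lam tend to 1 or 0 and every product of the factors 1 - jump
    tends to 0 or 1. There are finitely many such products, and 0 < U < 1 almost
    surely: for all small lam the threshold U is crossed exactly after the
    first date t_j >= t at which P_{t_j} > V_{t_j+}, that is, tau^lam_t is equal
    to tau^*_t ([tau_rand_eq_tau_star]).

    For a sequence of parameters the exceptional events of the rate are united.
    For the continuum lam -> 0+, V^lam is replaced by V on the null event where
    the rate fails; this family of versions obeys the rate for all lam > 0 off a
    single null event. *)

(** * Estimates on Phi and Psi *)

Section softplus.
Context (R : realType).
Implicit Types x y lam : R.

Lemma Phi_ln x : x != 0 -> Phi x = ln ((expR x - 1) / x).
Proof. by move=> x0; rewrite /Phi /Psi (negbTE x0) mulrA divff// mul1r. Qed.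

Lemma expR_quot_gt0 x : x != 0 -> 0 < (expR x - 1) / x.
Proof.
move=> x0; have [xpos|xneg|xE] := ltgtP x 0; last by rewrite xE eqxx in x0.
  by rewrite nmulr_rgt0 ?invr_lt0// subr_lt0 -expR0 ltr_expR.
by rewrite divr_gt0// subr_gt0 -expR0 ltr_expR.
Qed.

(** As Phi x = ln of the mean of exp (u x) over u in [0, 1], the change of
    variable u -> 1 - u reduces every bound on Phi to arguments of one sign. *)
Lemma PhiN x : Phi (- x) = Phi x - x.
Proof.
have [->|x0] := eqVneq x 0; first by rewrite oppr0 addr0.
rewrite !Phi_ln ?oppr_eq0//.
transitivity (ln ((expR x - 1) / x) - ln (expR x)); last by rewrite expRK.
rewrite -ln_div ?posrE ?expR_gt0 ?expR_quot_gt0//; congr ln; rewrite expRN; field.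
by rewrite x0 gt_eqF// expR_gt0.
Qed.

Lemma Phi_ge0 x : 0 <= x -> 0 <= Phi x.
Proof.
rewrite le_eqVlt => /predU1P[<-|x0]; first by rewrite /Phi mul0r.
rewrite Phi_ln ?gt_eqF// ln_ge0// ler_pdivlMr// mul1r.
by rewrite lerBrDl expR_ge1Dx.
Qed.

Lemma PhiN_le0 x : 0 <= x -> Phi (- x) <= 0.
Proof.
rewrite le_eqVlt => /predU1P[<-|x0]; first by rewrite oppr0 /Phi mul0r.
rewrite Phi_ln ?oppr_eq0 ?gt_eqF// ln_le0// ler_ndivrMr ?oppr_lt0// mul1r.
by rewrite lerBrDl expR_ge1Dx.
Qed.

(** This is (1 + x) exp (- x) <= 1 after clearing denominators. *)
Lemma PhiN_ge x : 0 <= x -> - ln (1 + x) <= Phi (- x).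
Proof.
rewrite le_eqVlt => /predU1P[<-|x0].
  by rewrite oppr0 /Phi mul0r addr0 ln1 oppr0.
rewrite Phi_ln ?oppr_eq0 ?gt_eqF// -lnV ?posrE ?addr_gt0//.
rewrite ler_ln ?posrE ?invr_gt0 ?addr_gt0 ?expR_quot_gt0 ?oppr_eq0 ?gt_eqF//.
rewrite invrN mulrN -mulNr opprB ler_pdivlMr// mulrC ler_pdivrMr ?addr_gt0//.
have := expR_ge1Dx x; rewrite -(ler_pM2r (expR_gt0 (- x))) -expRD subrr expR0.
by lra.
Qed.

Lemma Phi_bounds x : Num.min x 0 <= Phi x <= Num.max x 0.
Proof.
have [x0|/ltW x0] := leP x 0.
- have := @PhiN_le0 (- x); have := @Phi_ge0 (- x).
  by rewrite PhiN opprK !oppr_ge0 => /(_ x0) ? /(_ x0) ->; rewrite andbT; lra.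
- by rewrite Phi_ge0//=; have := PhiN_le0 x0; rewrite PhiN subr_le0.
Qed.

Lemma Phi_ge x : Num.max x 0 - ln (1 + `|x|) <= Phi x.
Proof.
have [x0|/ltW x0] := leP x 0.
- rewrite ler0_norm// sub0r; have := @PhiN_ge (- x).
  by rewrite opprK oppr_ge0; apply.
- by rewrite ger0_norm//; have := PhiN_ge x0; rewrite PhiN; lra.
Qed.

(** Squaring 1 + sqrt y <= exp (sqrt y) gives 1 + y <= exp (2 sqrt y). *)
Lemma ln1D_le_sqrt y : 0 <= y -> ln (1 + y) <= 2 * Num.sqrt y.
Proof.
move=> y0; have s0 := sqrtr_ge0 y.
have -> : 2 * Num.sqrt y = ln (expR (Num.sqrt y) ^+ 2).
  by rewrite -expRM_natl expRK mulr_natl.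
rewrite ler_ln ?posrE ?exprn_gt0 ?expR_gt0 ?ltr_pwDl//.
have /(lerXn2r 2) : 1 + Num.sqrt y <= expR (Num.sqrt y) := expR_ge1Dx _.
rewrite !nnegrE addr_ge0 ?expR_ge0// => /(_ isT isT); apply: le_trans.
by rewrite sqrrD sqr_sqrtr// expr1n mul1r; lra.
Qed.

(** The lower bound keeps the entropy-regularised value non-negative, the upper
    one keeps it below the value. *)
Lemma scaled_Phi_bounds lam x : 0 < lam ->
  Num.min x 0 <= lam * Phi (lam^-1 * x) <= Num.max x 0.
Proof.
move=> lam0; have l0 := ltW lam0.
have xE : x = lam * (lam^-1 * x) by rewrite mulrA divff ?gt_eqF// mul1r.
rewrite -(mulr0 lam) {1 4}xE -minr_pMr// -maxr_pMr// !ler_pM2l//.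
exact: Phi_bounds.
Qed.

(** Trading the logarithm for 2 sqrt (|x| / lam) makes the defect linear in |x|,
    since 2 sqrt |x| <= 1 + |x|; linearity is what lets the error be propagated
    through conditional expectations. *)
Lemma scaled_Phi_ge lam x : 0 < lam ->
  Num.max x 0 - Num.sqrt lam * (1 + `|x|) <= lam * Phi (lam^-1 * x).
Proof.
move=> lam0; have l0 := ltW lam0; have := Phi_ge (lam^-1 * x).
rewrite -(ler_pM2l lam0) mulrBr maxr_pMr// mulr0 mulrA divff ?gt_eqF// mul1r.
apply: le_trans; rewrite lerD2l lerN2 normrM (@ger0_norm _ lam^-1) ?invr_ge0//.
have h : ln (1 + lam^-1 * `|x|) <= 2 * Num.sqrt (lam^-1 * `|x|).
  by rewrite ln1D_le_sqrt// mulr_ge0// invr_ge0 ltW.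
apply: le_trans (ler_wpM2l l0 h) _.
rewrite sqrtrM ?invr_ge0// sqrtrV//.
set s := Num.sqrt lam; set r := Num.sqrt `|x|.
have s0 : 0 < s by rewrite sqrtr_gt0.
have lamE : lam = s ^+ 2 by rewrite sqr_sqrtr ?ltW.
have xE : `|x| = r ^+ 2 by rewrite sqr_sqrtr.
have -> : lam * (2 * (s^-1 * r)) = s * (2 * r).
  by rewrite lamE; field; rewrite gt_eqF.
rewrite ler_pM2l// xE -subr_ge0.
have -> : 1 + r ^+ 2 - 2 * r = (1 - r) ^+ 2 by ring.
exact: sqr_ge0.
Qed.

(** For x > 0, x - 2 sqrt x <= Phi x <= x; divide by x. *)
Lemma Psi_cvg_pinfty : Psi x @[x --> +oo] --> (1 : R).
Proof.
have sq : (Num.sqrt x)^-1 @[x --> +oo] --> (0 : R).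
  apply/gtr0_cvgV0.
    by near=> x; rewrite sqrtr_gt0; near: x; exact: nbhs_pinfty_gt.
  apply/cvgryPge => A.
  apply: filterS (nbhs_pinfty_ge (num_real (A ^+ 2))) => x xA.
  by rewrite (le_trans (ler_norm A))// -sqrtr_sqr ler_wsqrtr.
apply: (@squeeze_cvgr _ _ _ _ (fun x => 1 - 2 * (Num.sqrt x)^-1) (fun=> 1)).
- near=> x.
  have x0 : 0 < x by near: x; exact: nbhs_pinfty_gt.
  have -> : Psi x = Phi x / x by rewrite /Phi mulrAC divff ?gt_eqF// mul1r.
  rewrite ler_pdivlMr// ler_pdivrMr// mul1r.
  have /andP[_] := Phi_bounds x; rewrite (max_l (ltW x0)) => ->; rewrite andbT.
  have := Phi_ge x; rewrite (max_l (ltW x0)); apply: le_trans.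
  rewrite (ger0_norm (ltW x0)); have := ln1D_le_sqrt (ltW x0).
  have -> : (1 - 2 / Num.sqrt x) * x = x - 2 * Num.sqrt x.
    rewrite mulrBl mul1r -mulrA; congr (_ - _ * _).
    by rewrite -{2}(sqr_sqrtr (ltW x0)) mulKf// gt_eqF// sqrtr_gt0.
  by lra.
- rewrite -[X in _ --> X]subr0 -[X in _ --> _ - X](mulr0 2).
  by apply: cvgB; [exact: cvg_cst|apply: cvgM => //; exact: cvg_cst].
- exact: cvg_cst.
Unshelve. all: by end_near. Qed.

Lemma Psi_cvg_ninfty : Psi x @[x --> -oo] --> (0 : R).
Proof.
have PsiN x : x != 0 -> Psi x = 1 - Psi (- x).
  move=> x0; have := PhiN x; rewrite /Phi => /(canRL (mulKf _)).
  rewrite oppr_eq0 => /(_ x0) ->.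
  by rewrite invrN; field.
rewrite -[X in _ --> X](subrr 1).
apply: (@cvg_trans _ (1 - Psi (- x) @[x --> -oo])).
  apply: near_eq_cvg.
  apply: filterS (nbhs_ninfty_lt (num_real 0)) => x x0.
  by rewrite [RHS]PsiN// ltr0_neq0.
apply: cvgB; first exact: cvg_cst.
apply: (cvg_comp _ _ _ Psi_cvg_pinfty).
by apply: (proj2 (cvgNry id)); exact: cvg_id.
Unshelve. all: by end_near. Qed.

End softplus.

(** * From converging continuation values to converging stopping times *)

Lemma invM_cvg_pinfty (R : realType) (I : Type) (A : set_system I)
    (FA : Filter A) (lam y : I -> R) (l : R) :
  (\forall i \near A, 0 < lam i) -> lam i @[i --> A] --> 0 ->
  y i @[i --> A] --> l -> 0 < l ->
  (lam i)^-1 * y i @[i --> A] --> +oo.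
Proof.
move=> lam_gt0 lam_cvg y_cvg l0; apply/cvgryPge => B.
have l20 : 0 < l / 2 by rewrite divr_gt0.
have B0 : 0 < `|B| + 1 by rewrite ltr_pwDr.
have /(cvgr_lt _ lam_cvg) small : 0 < l / 2 / (`|B| + 1) by rewrite divr_gt0.
have /(cvgr_gt _ y_cvg) large : l / 2 < l by lra.
near=> i.
have li0 : 0 < lam i by near: i.
have yi : l / 2 < y i by near: i.
have : lam i < l / 2 / (`|B| + 1) by near: i.
rewrite ltr_pdivlMr// => li.
rewrite mulrC ler_pdivlMr//.
have := ler_norm B; rewrite -(ler_pM2r li0); nra.
Unshelve. all: by end_near. Qed.

Section stopping_rule.
Context (d : measure_display) (Om : measurableType d) (R : realType).
Variables (T : R) (N : nat) (g : 'I_N.+1 -> R) (P : R -> Om -> R).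
Variables (I : Type) (A : set_system I) (FA : Filter A).
Variables (lam : I -> R) (W : I -> R -> Om -> R) (w : Om).
Hypothesis lam_gt0 : \forall i \near A, 0 < lam i.
Hypothesis lam_cvg : lam i @[i --> A] --> (0 : R).

Lemma dGamma_cvg (v : R) (j : 'I_N.+1) :
  right_lim (W i) (g j) w @[i --> A] --> v -> v != P (g j) w ->
  dGamma g P (lam i) (W i) j w @[i --> A] --> ((v < P (g j) w)%R%:R : R).
Proof.
move=> W_cvg; rewrite neq_lt => /orP[vP|Pv].
- rewrite vP; apply: (cvg_comp _ _ _ (@Psi_cvg_pinfty R)).
  apply: (@invM_cvg_pinfty _ _ _ _ _ _ (P (g j) w - v)) => //; last lra.
  by apply: cvgB => //; exact: cvg_cst.
- rewrite ltNge (ltW Pv)/=; apply: (cvg_comp _ _ _ (@Psi_cvg_ninfty R)).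
  apply/cvgNry.
  rewrite (_ : - _ = fun i => (lam i)^-1 * (right_lim (W i) (g j) w - P (g j) w)).
    2: by apply/funext => i; rewrite /= -opprB mulrN.
  apply: (@invM_cvg_pinfty _ _ _ _ _ _ (v - P (g j) w)) => //; last lra.
  by apply: cvgB => //; exact: cvg_cst.
Qed.

(** Quantifying over all sets B of dates makes the threshold on the parameter
    uniform in the time s at which the survival product is evaluated. *)
Lemma stopped_before_cvg (v : 'I_N.+1 -> R) (u : R) : 0 < u < 1 ->
  (forall j, right_lim (W i) (g j) w @[i --> A] --> v j) ->
  (forall j, v j != P (g j) w) ->
  \forall i \near A, forall B : {set 'I_N.+1},
    (u <= 1 - \prod_(j in B) (1 - dGamma g P (lam i) (W i) j w)) =
    [exists j in B, v j < P (g j) w].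
Proof.
move=> /andP[u0 u1] W_cvg vP; apply: filter_forall => B.
(* The limit is 0 or 1, hence 1 minus it is on a definite side of u. *)
have Pi_cvg : \prod_(j in B) (1 - dGamma g P (lam i) (W i) j w) @[i --> A] -->
    (\prod_(j in B) (1 - (v j < P (g j) w)%R%:R) : R).
  apply: cvg_big => [|j _]; first exact: mul_continuous.
  by apply: cvgB; [exact: cvg_cst|exact: dGamma_cvg].
case: (boolP [exists j in B, v j < P (g j) w]) => [/existsP[j /andP[jB vj]]|].
- rewrite (bigD1 j)//= vj subrr mul0r in Pi_cvg.
  have u10 : 0 < 1 - u by rewrite subr_gt0.
  apply: filterS (cvgr_lt _ Pi_cvg _ u10) => i.
  by move=> h; apply/idP; lra.
- rewrite negb_exists => /forallP noj.
  rewrite big1 in Pi_cvg; last first.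
    by move=> j jB; have := noj j; rewrite jB/= => /negbTE ->; rewrite subr0.
  have u11 : 1 - u < 1 by lra.
  apply: filterS (cvgr_gt _ Pi_cvg _ u11) => i h.
  by apply/negbTE; rewrite -ltNge; lra.
Qed.

End stopping_rule.

(** Crossing times are strictly after the date that causes the crossing, because
    the survival product runs over dates strictly before s; passing to the
    infimum removes the strictness. *)
Lemma ereal_inf_after (R : realType) (I : Type) (J : set I) (g : I -> R)
    (t T : R) : (forall i, J i -> t <= g i) ->
  Order.min (ereal_inf [set s%:E | s in
      [set s | t <= s /\ exists2 i, J i & g i < s]]) T%:E =
  ereal_inf [set s%:E | s in [set s | s = T \/ exists2 i, J i & s = g i]].
Proof.
move=> Jt; apply/eqP; rewrite eq_le; apply/andP; split.
- apply/ereal_infP => _ [_ [->|[i Ji ->]] <-]; rewrite ge_min ?lexx ?orbT//.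
  apply/orP; left; apply/lee_addgt0Pr => e e0.
  apply: ereal_inf_lbound; exists (g i + e) => //; split.
    by rewrite (le_trans (Jt _ Ji))// lerDl ltW.
  by exists i => //; rewrite ltrDl.
- rewrite le_min; apply/andP; split; last first.
    by apply: ereal_inf_lbound; exists T => //; left.
  apply/ereal_infP => _ [s [_ [i Ji /ltW gis]] <-].
  apply: ge_ereal_inf; exists (g i)%:E; last by rewrite lee_fin.
  by exists (g i) => //; right; exists i.
Qed.

Lemma tau_rand_eq_tau_star (d : measure_display) (Om : measurableType d)
    (R : realType) (T : R) (N : nat) (g : 'I_N.+1 -> R) (P : R -> Om -> R)
    (U : Om -> R) (V : R -> Om -> R) (t : R) (w : Om)
    (I : Type) (A : set_system I) (FA : Filter A)
    (lam : I -> R) (W : I -> R -> Om -> R) :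
  t <= T -> 0 < U w < 1 ->
  V T w = P T w ->
  (forall j, V (g j) w = Num.max (right_lim V (g j) w) (P (g j) w)) ->
  (forall j, right_lim V (g j) w != P (g j) w) ->
  (\forall i \near A, 0 < lam i) -> lam i @[i --> A] --> (0 : R) ->
  (forall j, right_lim (W i) (g j) w @[i --> A] --> right_lim V (g j) w) ->
  \forall i \near A,
    tau_rand T g P U (lam i) (W i) t w = tau_star T g P V t w.
Proof.
move=> tT Uw VT Vg vP lam_gt0 lam_cvg W_cvg.
have := stopped_before_cvg FA lam_gt0 lam_cvg Uw W_cvg vP.
apply: filterS => i stopE.
pose J := [set j : 'I_N.+1 | t <= g j /\ right_lim V (g j) w < P (g j) w].
transitivity (ereal_inf
    [set s%:E | s in [set s | s = T \/ exists2 j, J j & s = g j]]).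
- rewrite -(@ereal_inf_after R 'I_N.+1 J g t T); last by move=> j [].
  rewrite /tau_rand; congr (Order.min (ereal_inf (_ @` _)) _).
  apply/seteqP; split => s /= [ts].
  + rewrite /survival.
    rewrite (eq_bigl (fun j => j \in finset (fun j => t <= g j < s)));
      last first.
      by move=> j; rewrite inE.
    rewrite stopE => /existsP[j]; rewrite inE => /andP[/andP[tj js] vj].
    by split => //; exists j.
  + move=> [j [tj vj] js]; split => //.
    rewrite /survival.
    rewrite (eq_bigl (fun j => j \in finset (fun j => t <= g j < s)));
      last first.
      by move=> k; rewrite inE.
    by rewrite stopE; apply/existsP; exists j; rewrite inE tj js.
- rewrite /tau_star; congr (ereal_inf (_ @` _)).
  apply/seteqP; split => s /=.
  + move=> [->|[j [tj vj] ->]]; split => //.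
    * by right.
    * by left; exists j.
    * by rewrite Vg max_r// ltW.
  + move=> [[[j _ <-]|->] ts]; last by left.
    rewrite Vg => Vj; right; exists j => //; split => //.
    by rewrite lt_neqAle vP/= -Vj le_max lexx.
Qed.

(** * Backward transport of affine inequalities along martingales *)

(** On the event where Z < 0 the variable D is negative with zero mean, so that
    this event is null. *)
Lemma ae_ge0_of_null_mean (d : measure_display) (Om : measurableType d)
    (R : realType) (Pr : probability Om R) (D Z : Om -> R) :
  integrable_rv Pr D -> measurable [set w | Z w < 0] ->
  (\int[Pr]_(w in [set w | (Z w < 0)%R]) (D w)%:E = 0)%E ->
  {ae Pr, forall w, D w <= Z w} -> {ae Pr, forall w, 0 <= Z w}.
Proof.
set A := [set w | Z w < 0] => intD mA D0 DZ.
have intDA : Pr.-integrable A (EFin \o D).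
  exact: (@integrableS _ _ _ Pr setT).
have /measurable_int mD := intDA.
have : (\int[Pr]_(w in A) `|(D w)%:E| = 0)%E.
  rewrite -[RHS]oppe0 -D0 -integralN/=; last first.
    exact: integrable_add_def.
  apply: ae_eq_integral => //.
  - exact: (measurable_int Pr (integrable_abse intDA)).
  - exact: (measurable_int Pr (integrableN intDA)).
  - apply: filterS DZ => w DZ Aw /=.
    by rewrite ltr0_norm// (le_lt_trans DZ).
move/(ae_eq_integral_abs Pr mA mD) => DA0.
apply: filterS2 DZ DA0 => w DZ DA0.
rewrite leNgt; apply/negP => Zw; have [Dw] := DA0 Zw.
by move: DZ; rewrite Dw leNgt Zw.
Qed.

Section backward.
Context (d : measure_display) (Om : measurableType d) (R : realType).
Variable Pr : probability Om R.

Lemma measurable_wrt_affine_lt0 (G : set (set Om)) (X Y : Om -> R)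
    (a b c : R) : sigma_algebra setT G ->
  measurable_wrt G X -> measurable_wrt G Y ->
  G [set w | a * X w + b * Y w + c < 0].
Proof.
move=> sG mX mY.
pose X' : g_sigma_algebraType G -> R := X.
pose Y' : g_sigma_algebraType G -> R := Y.
have mX' : measurable_fun setT X'.
  move=> _ B mB; rewrite setTI.
  by change (<<s G >> (X @^-1` B)); rewrite sigma_algebra_id//; exact: mX.
have mY' : measurable_fun setT Y'.
  move=> _ B mB; rewrite setTI.
  by change (<<s G >> (Y @^-1` B)); rewrite sigma_algebra_id//; exact: mY.
have mZ : measurable_fun setT (fun w => a * X' w + b * Y' w + c).
  by do 2 (apply: measurable_funD => //); apply: measurable_funM => //.
have := mZ measurableT `]-oo, 0[%classic (measurable_itv _).
rewrite setTI set_itvNyo/= => mA.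
have : <<s G >> [set w | a * X w + b * Y w + c < 0] by exact: mA.
by rewrite sigma_algebra_id.
Qed.

Variables (F : R -> set (set Om)) (T : R).
Hypothesis hF : usual_filtration Pr F.

(** When the combination is non-negative at time u, the increment
    a (M1_s - M1_u) + b (M2_s - M2_u) is a lower bound of the combination at
    time s, and it has zero mean on every event of F_s. *)
Lemma affine_ge0_backward (V1 V2 M1 M2 : R -> Om -> R) (s u a b c : R) :
  adapted F T V1 -> adapted F T V2 ->
  ui_martingale Pr F T M1 -> ui_martingale Pr F T M2 ->
  0 <= s -> s <= u -> u <= T ->
  {ae Pr, forall w, V1 s w = V1 u w - (M1 u w - M1 s w)} ->
  {ae Pr, forall w, V2 s w = V2 u w - (M2 u w - M2 s w)} ->
  {ae Pr, forall w, 0 <= a * V1 u w + b * V2 u w + c} ->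
  {ae Pr, forall w, 0 <= a * V1 s w + b * V2 s w + c}.
Proof.
move=> aV1 aV2 mM1 mM2 s0 su uT V1su V2su Vu.
have hs : 0 <= s <= T by rewrite s0 (le_trans su).
have [iM1u iM1s _ M1E] := mart_condexp mM1 s0 su uT.
have [iM2u iM2s _ M2E] := mart_condexp mM2 s0 su uT.
have FA := @measurable_wrt_affine_lt0 _ _ _ a b c (filt_sigma hF s0)
  (aV1 _ hs) (aV2 _ hs).
have mA := filt_sub hF s0 FA.
pose A := [set w | a * V1 s w + b * V2 s w + c < 0].
pose D w := a * (M1 s w - M1 u w) + b * (M2 s w - M2 u w).
have iS : forall X : Om -> R, integrable_rv Pr X -> forall B, measurable B ->
    Pr.-integrable B (EFin \o X).
  by move=> X iX B mB; exact: (@integrableS _ _ _ Pr setT).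
have iB (X Y : Om -> R) : integrable_rv Pr X -> integrable_rv Pr Y ->
    integrable_rv Pr (fun w => X w - Y w).
  by move=> iX iY; exact: (@integrableB _ _ _ Pr setT _ (EFin \o X) (EFin \o Y)).
have iZ (k : R) (X : Om -> R) : integrable_rv Pr X ->
    integrable_rv Pr (fun w => k * X w).
  by move=> iX; exact: (@integrableZl _ _ _ Pr setT _ k (EFin \o X)).
have iD1 := iB _ _ iM1s iM1u; have iD2 := iB _ _ iM2s iM2u.
have iD : integrable_rv Pr D.
  exact: (@integrableD _ _ _ Pr setT _ (EFin \o _) (EFin \o _)
    (iZ a _ iD1) (iZ b _ iD2)).
apply: (@ae_ge0_of_null_mean _ _ _ Pr D) => //.
- have diff0 (X Y : Om -> R) (k : R) : integrable_rv Pr X ->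
      integrable_rv Pr Y ->
      (\int[Pr]_(w in A) (X w)%:E = \int[Pr]_(w in A) (Y w)%:E)%E ->
      (\int[Pr]_(w in A) (k * (X w - Y w))%:E = 0)%E.
    move=> iX iY XY; under eq_integral do rewrite EFinM.
    rewrite (integralZl mA (iS _ (iB _ _ iX iY) _ mA)).
    rewrite /=; under eq_integral do rewrite EFinB.
    rewrite (integralB_EFin mA (iS _ iX _ mA) (iS _ iY _ mA)) XY.
    by rewrite subee ?mule0//; exact: integrable_fin_num (iS _ iY _ mA).
  under eq_integral do rewrite EFinD.
  rewrite (integralD_EFin mA (iS _ (iZ a _ iD1) _ mA) (iS _ (iZ b _ iD2) _ mA)).
  by rewrite !diff0// ?adde0// ?M1E// ?M2E.
- apply: filterS3 V1su V2su Vu => w -> ->; rewrite /D; lra.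
Qed.

End backward.

(** * One step of the comparison *)

(** The error is measured relative to 1 + x, where x is the unregularised value:
    this makes the three inequalities affine in (x, y), and k (1 + x) can only
    grow when x jumps up to max (x, p). *)
Definition sandwiched (R : realType) (k x y : R) : bool :=
  [&& 0 <= y, y <= x & x - y <= k * (1 + x)].

Lemma sandwiched_weaken (R : realType) (k k' x y : R) :
  k <= k' -> sandwiched k x y -> sandwiched k' x y.
Proof.
move=> kk' /and3P[y0 yx xy]; apply/and3P; split => //.
apply: (le_trans xy); rewrite ler_wpM2r//.
by rewrite addr_ge0// (le_trans y0).
Qed.

(** With m = max (x, p), the new value of x: the difference of positive parts
    contributes at most x - y, and the defect of lam * Phi (./lam) at most
    sqrt lam (1 + |p - y|), where |p - y| <= m because p and y lie in [0, m]. *)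
Lemma sandwiched_jump (R : realType) (k lam p x y : R) :
  0 < lam -> 0 <= p -> 0 <= k -> sandwiched k x y ->
  sandwiched (k + Num.sqrt lam) (x + Num.max (p - x) 0)
             (y + lam * Phi (lam^-1 * (p - y))).
Proof.
move=> lam0 p0 k0 /and3P[y0 yx xy].
have /andP[] := scaled_Phi_bounds (p - y) lam0.
have := scaled_Phi_ge (p - y) lam0; have := sqrtr_ge0 lam.
set f := lam * _; set s := Num.sqrt lam => s0.
set m := x + Num.max (p - x) 0.
have mx : x <= m by rewrite lerDl le_max lexx orbT.
have mp : p <= m by rewrite -lerBlDl le_max lexx.
have mle : m <= x + Num.max (p - y) 0.
  by rewrite lerD2l ge_max !le_max lexx lerD2l lerN2 yx !orbT.
have absE : `|p - y| <= m by rewrite ler_norml; apply/andP; split; lra.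
have mE : m = x \/ m = p.
  by rewrite /m; case: (leP (p - x) 0) => _; [left|right]; lra.
have h1 : s * (1 + `|p - y|) <= s * (1 + m) by rewrite ler_wpM2l// lerD2l.
have h2 : k * (1 + x) <= k * (1 + m) by rewrite ler_wpM2l// lerD2l.
rewrite minEle maxEle => f1 f2 f3; apply/and3P.
case: ifP f1 f2 f3 => [h|/negbT]; last rewrite -ltNge => h.
  by move=> f1 f2 f3; split; lra.
by move=> f1 f2 f3; split; case: mE => mE; rewrite ?mulrDl; lra.
Qed.

(** * Paths of a reward equation on the grid *)

Section grid.
Context (R : realType) (T : R) (N : nat) (g : 'I_N.+1 -> R).
Hypothesis hg : exercise_grid T g.

Lemma grid_ge0 j : 0 <= g j.
Proof.
rewrite -(grid0 hg); have [->//|j0] := eqVneq j ord0.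
by apply: ltW; apply: (grid_incr hg); rewrite lt0n.
Qed.

Lemma grid_ltT j : g j < T.
Proof.
apply: le_lt_trans (grid_lt hg); have [->//|jN] := eqVneq j ord_max.
by apply: ltW; apply: (grid_incr hg); rewrite ltn_neqAle jN -ltnS ltn_ord.
Qed.

Lemma grid_inj : injective g.
Proof.
move=> i j gij; apply: val_inj.
have [/(grid_incr hg)|/(grid_incr hg)|//] := ltngtP (val i) (val j).
  by rewrite gij ltxx.
by rewrite gij ltxx.
Qed.

Lemma grid_right_nbhd j : \forall r \near (g j)^'+,
  [/\ g j < r, r <= T & forall i, (r <= g i) = (g j < g i)].
Proof.
have H : \forall r \near (g j)^'+, forall i, (r <= g i) = (g j < g i).
  apply: filter_forall => i; have [ji|ij] := ltP (g j) (g i).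
    by near=> r; apply/idP; near: r; exact: nbhs_right_le.
  apply: filterS (nbhs_right_gt (g j)) => r jr.
  by apply/negbTE; rewrite -ltNge (le_lt_trans ij).
near=> r; split; near: r => //; first exact: nbhs_right_gt.
by apply: nbhs_right_le; exact: grid_ltT.
Unshelve. all: by end_near. Qed.

Definition remaining (s : R) : nat := #|finset (fun i => s <= g i)|.

End grid.

(** The pathwise content of [reward_equation]; keeping it as a named predicate
    lets the reward function f be inferred from the hypothesis. *)
Definition reward_path (d : measure_display) (Om : measurableType d)
    (R : realType) (T : R) (N : nat) (g : 'I_N.+1 -> R) (P : R -> Om -> R) 
    (f : R -> R) (V M : R -> Om -> R) (w : Om) : Prop :=
  forall t, 0 <= t <= T ->
    V t w = P T w - (M T w - M t w)
      + \sum_(i < N.+1 | t <= g i < T) f (P (g i) w - right_lim V (g i) w).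

Section reward_path.
Context (d : measure_display) (Om : measurableType d) (R : realType).
Variables (T : R) (N : nat) (g : 'I_N.+1 -> R) (P : R -> Om -> R).
Hypothesis hg : exercise_grid T g.
Variables (f : R -> R) (V M : R -> Om -> R) (w : Om).
Hypothesis VE : reward_path T g P f V M w.

Lemma reward_terminal : 0 <= T -> V T w = P T w.
Proof.
move=> T0; rewrite VE ?T0 ?lexx// subrr subr0 big_pred0 ?addr0// => i.
by apply/negbTE/negP => /andP[]; rewrite leNgt => /negP.
Qed.

Lemma reward_between s u : 0 <= s <= T -> 0 <= u <= T ->
  (forall i, (s <= g i) = (u <= g i)) ->
  V s w = V u w - (M u w - M s w).
Proof.
move=> hs hu su; rewrite !VE//.
rewrite (eq_bigl (fun i => u <= g i < T)); first by ring.
by move=> i; rewrite su.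
Qed.

Hypothesis cM : cadlag T (M^~ w).

(** Just after t_j the sum no longer contains the term of t_j and is constant, so
    that V has a right limit there because the martingale is right-continuous. *)
Lemma reward_right_lim j : V r w @[r --> (g j)^'+] --> right_lim V (g j) w
  /\ V (g j) w = right_lim V (g j) w + f (P (g j) w - right_lim V (g j) w).
Proof.
have gj0 := grid_ge0 hg j; have gjT := grid_ltT hg j.
pose c i := f (P (g i) w - right_lim V (g i) w).
pose S := \sum_(i < N.+1 | g j < g i < T) c i.
have V_cvg : V r w @[r --> (g j)^'+] --> P T w - (M T w - M (g j) w) + S.
  apply: (@cvg_trans _ (P T w - (M T w - M r w) + S @[r --> (g j)^'+])).
    apply: near_eq_cvg; near=> r.
    have [jr rT rg] : [/\ g j < r, r <= T & forall i, (r <= g i) = (g j < g i)].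
      by near: r; exact: grid_right_nbhd.
    rewrite VE; last by rewrite rT (le_trans gj0)// ltW.
    by congr (_ + _); apply: eq_bigl => i; rewrite rg.
  apply: cvgD; last exact: cvg_cst.
  apply: cvgB; first exact: cvg_cst.
  by apply: cvgB; [exact: cvg_cst|exact: cM.1].
have limE : right_lim V (g j) w = P T w - (M T w - M (g j) w) + S.
  exact: cvg_lim V_cvg.
split; first by rewrite limE.
have sumE : \sum_(i < N.+1 | g j <= g i < T) c i = c j + S.
  rewrite (bigD1 j) ?lexx ?gjT//=; congr (_ + _); apply: eq_bigl => i.
  rewrite (lt_neqAle (g j)) (inj_eq (grid_inj hg)) (eq_sym j).
  by rewrite andbC andbA.
have -> : V (g j) w = P T w - (M T w - M (g j) w) + (c j + S).
  by rewrite VE ?sumE// gj0 ltW.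
by rewrite addrCA addrC; congr (_ + _).
Unshelve. all: by end_near. Qed.

End reward_path.

(** * The rate of convergence of the continuation values *)

(** The shape expected by [affine_ge0_backward]. *)
Lemma sandwichedP (R : realType) (k x y : R) :
  reflect [/\ 0 <= 0 * x + 1 * y + 0, 0 <= 1 * x + -1 * y + 0 &
              0 <= (k - 1) * x + 1 * y + k] (sandwiched k x y).
Proof.
by apply: (iffP and3P) => -[h1 h2 h3]; split; lra.
Qed.

Lemma sandwiched_cvg (R : realType) (k x y : R) (u v : nat -> R) :
  u n @[n --> \oo] --> x -> v n @[n --> \oo] --> y ->
  (forall n, sandwiched k (u n) (v n)) -> sandwiched k x y.
Proof.
move=> ux vy uv; apply/and3P; split.
- by apply: (ler_cvg_to (cvg_cst 0) vy); apply: nearW => n; case/and3P: (uv n).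
- by apply: (ler_cvg_to vy ux); apply: nearW => n; case/and3P: (uv n).
- apply: (@ler_cvg_to _ \oo _ _ (fun n => u n - v n) (fun n => k * (1 + u n))).
  + exact: cvgB.
  + by apply: cvgM; [exact: cvg_cst|apply: cvgD => //; exact: cvg_cst].
  + by apply: nearW => n; case/and3P: (uv n).
Qed.

Lemma remaining_right (R : realType) (T : R) (N : nat) (g : 'I_N.+1 -> R)
    (j : 'I_N.+1) (r : R) : exercise_grid T g ->
  (forall i, (r <= g i) = (g j < g i)) ->
  remaining g (g j) = (remaining g r).+1.
Proof.
move=> hg rg; rewrite /remaining (cardsD1 j) inE lexx add1n; congr _.+1.
apply: eq_card => i; rewrite !inE rg lt_neqAle (inj_eq (grid_inj hg)).
by rewrite eq_sym.
Qed.

(** Almost sure statements at uncountably many times can only be combined along a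
    sequence. *)
Lemma at_right_seq (R : realType) (x : R) (Q : R -> Prop) :
  (\forall r \near x^'+, Q r) ->
  exists u : nat -> R, [/\ forall n, x < u n, u n @[n --> \oo] --> x &
    forall n, Q (u n)].
Proof.
case=> e /= e0 he; pose u (n : nat) := x + e / 2 * n.+1%:R^-1.
have e20 : 0 < e / 2 by rewrite divr_gt0.
have xu n : x < u n by rewrite ltrDl mulr_gt0// invr_gt0.
exists u; split => //.
- rewrite -[X in _ --> X]addr0 -[X in _ --> x + X](mulr0 (e / 2)).
  apply: cvgD; first exact: cvg_cst.
  by apply: cvgM; [exact: cvg_cst|exact: cvg_harmonic].
- move=> n; apply: he; last exact: xu.
  rewrite /= distrC ger0_norm ?subr_ge0 ?ltW// addrC addKr.
  apply: (@le_lt_trans _ _ (e / 2)); last lra.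
  by rewrite ler_piMr ?(ltW e20)// invf_le1// ler1n.
Qed.

Section entropic_bound.
Context (d : measure_display) (Om : measurableType d) (R : realType).
Variables (Pr : probability Om R) (F : R -> set (set Om)).
Hypothesis hF : usual_filtration Pr F.
Variables (T : R) (N : nat) (g : 'I_N.+1 -> R).
Hypotheses (T_ge0 : 0 <= T) (hg : exercise_grid T g).
Variables (P V M : R -> Om -> R).
Hypotheses (hP : payoff_process Pr F T g P) (hV : value_process Pr F T g P V M).
Variables (lam : R) (W L : R -> Om -> R).
Hypotheses (lam_gt0 : 0 < lam) (hW : entropy_value Pr F T g P lam W L).

Let VE : {ae Pr, forall w, reward_path T g P (fun x => Num.max x 0) V M w} :=
  value_equation hV.
Let WE : {ae Pr, forall w,
    reward_path T g P (fun x => lam * Phi (lam^-1 * x)) W L w} :=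
  entropy_equation hW.
Let cM := mart_cadlag (value_martingale hV).
Let cL := mart_cadlag (entropy_martingale hW).

Lemma ae_sandwiched_right_lim (j : 'I_N.+1) (k : R) :
  (\forall r \near (g j)^'+, {ae Pr, forall w, sandwiched k (V r w) (W r w)}) ->
  {ae Pr, forall w,
    sandwiched k (right_lim V (g j) w) (right_lim W (g j) w)}.
Proof.
move=> /at_right_seq[u [ju u_cvg /ae_foralln uS]].
apply: filterS3 (filterI VE cM) (filterI WE cL) uS => w [Vw Mw] [Ww Lw] Sw.
have [V_cvg _] := reward_right_lim hg Vw Mw j.
have [W_cvg _] := reward_right_lim hg Ww Lw j.
apply: (@sandwiched_cvg _ _ _ _ (fun n => V (u n) w) (fun n => W (u n) w)) => //.
- by apply: ((cvg_at_rightP _ _ _).1 V_cvg).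
- by apply: ((cvg_at_rightP _ _ _).1 W_cvg).
Qed.

Lemma ae_sandwiched_between (s u k : R) : 0 <= s -> s <= u -> u <= T ->
  (forall i, (s <= g i) = (u <= g i)) ->
  {ae Pr, forall w, sandwiched k (V u w) (W u w)} ->
  {ae Pr, forall w, sandwiched k (V s w) (W s w)}.
Proof.
move=> s0 su uT sug Su.
have hs : 0 <= s <= T by rewrite s0 (le_trans su).
have hu : 0 <= u <= T by rewrite uT (le_trans s0).
have Vsu : {ae Pr, forall w, V s w = V u w - (M u w - M s w)}.
  by apply: filterS VE => w Vw; exact: (reward_between Vw).
have Wsu : {ae Pr, forall w, W s w = W u w - (L u w - L s w)}.
  by apply: filterS WE => w Ww; exact: (reward_between Ww).
have back a b c := @affine_ge0_backward _ _ _ Pr F T hF V W M L s u a b c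
  (value_adapted hV) (entropy_adapted hW) (value_martingale hV)
  (entropy_martingale hW) s0 su uT Vsu Wsu.
have h1 := back 0 1 0; have h2 := back 1 (-1) 0; have h3 := back (k - 1) 1 k.
apply: filterS3 (h1 _) (h2 _) (h3 _).
- by move=> w a1 a2 a3; apply/sandwichedP.
- by apply: filterS Su => w /sandwichedP[].
- by apply: filterS Su => w /sandwichedP[].
- by apply: filterS Su => w /sandwichedP[].
Qed.

Lemma ae_sandwiched_grid (j : 'I_N.+1) (k : R) : 0 <= k ->
  {ae Pr, forall w,
    sandwiched k (right_lim V (g j) w) (right_lim W (g j) w)} ->
  {ae Pr, forall w,
    sandwiched (k + Num.sqrt lam) (V (g j) w) (W (g j) w)}.
Proof.
move=> k0; apply: filterS3 (filterI VE cM) (filterI WE cL) => w [Vw Mw] [Ww Lw].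
have [_ ->] := reward_right_lim hg Vw Mw j.
have [_ ->] := reward_right_lim hg Ww Lw j.
apply: sandwiched_jump => //; apply: (payoff_ge0 hP).
by rewrite (grid_ge0 hg) ltW// (grid_ltT hg).
Qed.

(** Induction on the number of remaining dates. From s one goes forward to the
    first remaining date t_j without crossing a date, through the jump at t_j,
    and then to times right after t_j, which have one remaining date fewer. *)
Lemma ae_sandwiched (s : R) : 0 <= s <= T ->
  {ae Pr, forall w,
    sandwiched (Num.sqrt lam * (remaining g s)%:R) (V s w) (W s w)}.
Proof.
move: {2}(remaining g s) (erefl (remaining g s)) => n.
elim: n s => [|n IH] s sn /andP[s0 sT].
- apply: (ae_sandwiched_between s0 sT) => //.
    move=> i; rewrite [RHS]leNgt (grid_ltT hg)/=.
    move/eqP: sn; rewrite cards_eq0 => /eqP/setP/(_ i).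
    by rewrite !inE.
  apply: filterS2 VE WE => w Vw Ww.
  rewrite (reward_terminal Vw T_ge0) (reward_terminal Ww T_ge0).
  have PT := payoff_ge0 hP w (t := T); rewrite T_ge0 lexx in PT.
  by apply/and3P; split; rewrite ?PT// subrr mulr_ge0// ?mulr_ge0 ?sqrtr_ge0//
    addr_ge0// PT.
- have [i si] : exists i, s <= g i.
    have /card_gt0P[i] : (0 < remaining g s)%N by rewrite sn.
    by rewrite inE; exists i.
  pose j := [arg min_(k < i | s <= g k) g k]%O.
  have [sj jmin] : s <= g j /\ forall k, s <= g k -> g j <= g k.
    by rewrite /j; case: arg_minP => // k; split.
  have sjg k : (s <= g k) = (g j <= g k).
    by apply/idP/idP => [/jmin//|]; exact: le_trans.
  have sE : remaining g s = remaining g (g j).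
    by apply: eq_card => k; rewrite !inE sjg.
  apply: (ae_sandwiched_between s0 sj (ltW (grid_ltT hg j)) sjg).
  rewrite sn -addn1 natrD mulrDr mulr1.
  apply: ae_sandwiched_grid; first by rewrite mulr_ge0// sqrtr_ge0.
  apply: ae_sandwiched_right_lim.
  apply: filterS (grid_right_nbhd hg j) => r [jr rT rg].
  have rn : remaining g r = n.
    by move: sn; rewrite sE (remaining_right hg rg) => -[].
  rewrite -rn; apply: IH => //.
  by rewrite rT (le_trans (grid_ge0 hg j))// ltW.
Qed.

Lemma ae_sandwiched_grid_right :
  {ae Pr, forall w, forall j, sandwiched (Num.sqrt lam * N.+1%:R)
    (right_lim V (g j) w) (right_lim W (g j) w)}.
Proof.
apply: filter_forall => j; apply: ae_sandwiched_right_lim.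
apply: filterS (grid_right_nbhd hg j) => r [jr rT _].
have hr : 0 <= r <= T by rewrite rT (le_trans (grid_ge0 hg j))// ltW.
apply: filterS (ae_sandwiched hr) => w; apply: sandwiched_weaken.
rewrite ler_wpM2l ?sqrtr_ge0// ler_nat.
by rewrite (leq_trans (max_card _))// card_ord.
Qed.

End entropic_bound.

(** * Almost sure convergence *)

Lemma sandwiched_cvg_sqrt (R : realType) (I : Type) (A : set_system I)
    (FA : Filter A) (lam y : I -> R) (c x : R) :
  lam i @[i --> A] --> (0 : R) ->
  (\forall i \near A, sandwiched (Num.sqrt (lam i) * c) x (y i)) ->
  y i @[i --> A] --> x.
Proof.
move=> lam_cvg xy.
apply: (@squeeze_cvgr _ _ _ _
    (fun i => x - Num.sqrt (lam i) * c * (1 + x)) (fun=> x)).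
- by apply: filterS xy => i /and3P[_ yx]; rewrite yx andbT; lra.
- rewrite -[X in _ --> X]subr0 -(mul0r (1 + x)) -(mul0r c).
  apply: cvgB; first exact: cvg_cst.
  apply: cvgM; last exact: cvg_cst.
  apply: cvgM; last exact: cvg_cst.
  rewrite -(@sqrtr0 R).
  exact: (cvg_comp _ _ lam_cvg (@sqrt_continuous R 0)).
- exact: cvg_cst.
Qed.

Lemma uniform01_ae_interior (d : measure_display) (Om : measurableType d)
    (R : realType) (Pr : probability Om R) (U : Om -> R) :
  uniform01 Pr U -> {ae Pr, forall w, 0 < U w < 1}.
Proof.
move=> [mU UE].
have mB : measurable (~` `]0, 1[%classic : set R) by apply: measurableC.
exists (U @^-1` (~` `]0, 1[%classic)); split.
- by rewrite -[X in measurable X]setTI; exact: mU.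
- rewrite UE// /uniform_prob integral_uniform_pdf.
  apply: null_set_integral.
  + exact: measurableI.
  + apply: measurable_funTS; apply: measurableT_comp => //.
    exact: measurable_uniform_pdf.
  (* Only the two endpoints of [0, 1] are left. *)
  + apply: countable_lebesgue_measure0; apply: (@sub_countable _ _ _ [set 0; 1]).
      apply: subset_card_le => x [+ +]; rewrite /= !in_itv/=.
      move=> /negP; rewrite negb_and -!leNgt => /orP[h|h] /andP[x0 x1].
        by left; apply/eqP; rewrite eq_le h.
      by right; apply/eqP; rewrite eq_le x1.
    exact: finite_set_countable (finite_set2 _ _).
- by move=> w /= Uw h; apply: Uw; move: h; rewrite in_itv.
Qed.

(** Stated for an arbitrary filter, so as to cover both sequences of parameters
    and the right neighbourhoods of 0. *)
Lemma tau_rand_cvg (d : measure_display) (Om : measurableType d)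
    (R : realType) (T : R) (N : nat) (g : 'I_N.+1 -> R) (P : R -> Om -> R)
    (U : Om -> R) (V M : R -> Om -> R) (t : R) (w : Om)
    (I : Type) (A : set_system I) (FA : Filter A)
    (lam : I -> R) (W : I -> R -> Om -> R) :
  exercise_grid T g -> 0 <= t <= T -> 0 < U w < 1 ->
  reward_path T g P (fun x => Num.max x 0) V M w -> cadlag T (M^~ w) ->
  (forall j, right_lim V (g j) w != P (g j) w) ->
  (\forall i \near A, 0 < lam i) -> lam i @[i --> A] --> (0 : R) ->
  (\forall i \near A, forall j, sandwiched (Num.sqrt (lam i) * N.+1%:R)
     (right_lim V (g j) w) (right_lim (W i) (g j) w)) ->
  tau_rand T g P U (lam i) (W i) t w @[i --> A] --> tau_star T g P V t w.
Proof.
move=> hg /andP[t0 tT] Uw Vw Mw vP lam_gt0 lam_cvg WS.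
apply: cvg_near_cst; apply: tau_rand_eq_tau_star => //.
- by apply: (reward_terminal Vw); exact: le_trans tT.
- move=> j; have [_ ->] := reward_right_lim hg Vw Mw j.
  by rewrite !maxEle; case: ifP; case: ifP; lra.
- move=> j; apply: (@sandwiched_cvg_sqrt _ _ _ _ lam
    (fun i => right_lim (W i) (g j) w) N.+1%:R) => //.
  by apply: filterS WS => i; apply.
Qed.

Theorem theorem3p2 (d : measure_display) (Om : measurableType d)
    (R : realType) (Pr : probability Om R)
    (F : R -> set (set Om)) (hF : usual_filtration Pr F)
    (T : R) (hT : 0 < T)
    (N : nat) (g : 'I_N.+1 -> R) (hg : exercise_grid T g)
    (P : R -> Om -> R) (hP : payoff_process Pr F T g P)
    (V M : R -> Om -> R) (hV : value_process Pr F T g P V M)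
    (Vl Ml : R -> R -> Om -> R)
    (hVl : forall lam : R, 0 < lam ->
      entropy_value Pr F T g P lam (Vl lam) (Ml lam))
    (U : Om -> R) (hU : uniform01 Pr U)
    (hUind : independent_of Pr (F_infty F) U)
    (hnull : Pr.-negligible
      (\bigcup_(j in [set: 'I_N.+1])
        [set w | right_lim V (g j) w = P (g j) w]))
    (t : R) (ht : 0 <= t <= T) :
  (forall lam : nat -> R, (forall n, 0 < lam n) ->
    lam n @[n --> \oo] --> (0 : R) ->
    {ae Pr, forall w,
      tau_rand T g P U (lam n) (Vl (lam n)) t w @[n --> \oo]
        --> tau_star T g P V t w})
  /\
  (exists2 V' : R -> R -> Om -> R, same_versions Pr T Vl V' &
    {ae Pr, forall w,
      tau_rand T g P U lam (V' lam) t w @[lam --> (0 : R)^'+]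
        --> tau_star T g P V t w}).
Proof.
pose close lam w := forall j, sandwiched (Num.sqrt lam * N.+1%:R)
  (right_lim V (g j) w) (right_lim (Vl lam) (g j) w).
have close_ae lam : 0 < lam -> {ae Pr, forall w, close lam w}.
  move=> lam0.
  exact: (ae_sandwiched_grid_right hF (ltW hT) hg hP hV lam0 (hVl _ lam0)).
have good : {ae Pr, forall w, [/\ 0 < U w < 1,
    reward_path T g P (fun x => Num.max x 0) V M w, cadlag T (M^~ w) &
    forall j, right_lim V (g j) w != P (g j) w]}.
  have vP : {ae Pr, forall w, forall j, right_lim V (g j) w != P (g j) w}.
    apply: negligibleS hnull => w /existsNP[j /negP]; rewrite negbK => /eqP vp.
    by exists j.
  have VE : {ae Pr, forall w,
    reward_path T g P (fun x => Num.max x 0) V M w} := value_equation hV.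
  have cM := mart_cadlag (value_martingale hV).
  apply: filterS2 (filterI (uniform01_ae_interior hU) VE) (filterI cM vP).
  by move=> w [Uw Vw] [Mw vw]; split.
split.
- move=> lam lam_gt0 lam_cvg.
  have /ae_foralln closeN n := close_ae _ (lam_gt0 n).
  apply: filterS2 good closeN => w [Uw Vw Mw vP] cw.
  apply: (@tau_rand_cvg _ _ _ _ _ _ _ _ _ M _ _ nat \oo _ lam
    (fun n => Vl (lam n))) => //.
  + by apply: nearW => n; exact: lam_gt0.
  + by apply: nearW => n; exact: cw.
(* Falling back on V itself costs nothing: its distance to V is 0. *)
- pose V' lam s w := if `[< close lam w >] then Vl lam s w else V s w.
  exists V'.
    move=> lam lam0; apply: filterS (close_ae _ lam0) => w cw s _.
    by rewrite /V' asboolT.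
  apply: filterS2 good (close_ae _ ltr01) => w [Uw Vw Mw vP] c1.
  apply: (@tau_rand_cvg _ _ _ _ _ _ _ _ _ M _ _ _ _ _ id V') => //.
  + exact: nbhs_right_gt.
  + exact: cvg_at_right_filter.
  + near=> lam => j; rewrite /V' /right_lim.
    case: (asboolP (close lam w)) => [cw|_]; first exact: cw.
    have /and3P[v0 vv _] := c1 j; have x0 := le_trans v0 vv.
    apply/and3P; split=> //; rewrite subrr.
    by rewrite mulr_ge0 ?addr_ge0// mulr_ge0// sqrtr_ge0.
Unshelve. all: by end_near. Qed.
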